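(* For every integer $d \ge 3$, $p_{lin}^{d-1}(d) = 2$.
   Context: For an integer $n\ge 1$, the $n$-dimensional hypercube $Q_n$ is the graph with vertex set $\{0,1\}^n$ and edges between vertices that differ in exactly one coordinate. For $1 \le d \le n$, a $d$-dimensional subcube of $Q_n$ (a ''$Q_d$ in $Q_n$'') is represented by a string of length $n$ over $\{0,1,*\}$ with exactly $d$ stars; its vertices are the $2^d$ binary strings obtained by replacing each star by 0 or 1. A $Q_\ell$ is contained in a $Q_d$ if its vertex set is contained in that of the $Q_d$ (equivalently, its string is obtained from that of the $Q_d$ by replacing $d-\ell$ of the stars by 0's or 1's). Counting vector: for a $Q_\ell$ in $Q_n$, its counting vector is $(v_0,\ldots,v_\ell)\in \mathbb{Z}_{\ge 0}^{\ell+1}$, where $v_0$ is the number of 1's to the left of the first star, $v_\ell$ is the number of 1's to the right of the $\ell$th (last) star, and for $1\le i\le \ell-1$, $v_i$ is the number of 1's between the $i$th and $(i+1)$st stars. A $Q_\ell$-coloring of $Q_n$ is an assignment of a color from a set of colors to each $Q_\ell$ in $Q_n$. For integers $n \ge d \ge \ell \ge 1$, a $Q_\ell$-coloring of $Q_n$ is $d$-polychromatic if every $Q_d$ in $Q_n$ contains a $Q_\ell$ of every color in the set of colors. A $Q_\ell$-coloring is linear if the set of colors is a finite abelian group $Z$ and there is an additive map $\chi:\mathbb{Z}_{\ge 0}^{\ell+1}\to Z$ (i.e. $\chi(v_0,\ldots,v_\ell)=\sum_{i=0}^{\ell} v_i h_i$ for some fixed $h_0,\ldots,h_\ell\in Z$)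 such that each $Q_\ell$ receives the color $\chi(v)$, where $v$ is its counting vector. The number of colors of such a coloring is $|Z|$. For $1\le \ell\le d$, $p_{lin}^{\ell}(d)$ denotes the maximum number of colors $M$ such that for all $n\ge d$, $Q_n$ has a $d$-polychromatic linear $Q_\ell$-coloring with $M$ colors. *)

(* Defs.v *)
From HB Require Import structures.
From mathcomp Require Import all_boot all_order all_algebra.
Set Implicit Arguments.
Unset Strict Implicit.
Unset Printing Implicit Defensive.
Import GRing.Theory.

(* A string over {0,1,*} of length n with exactly d stars:
   [Some false] is 0, [Some true] is 1 and [None] is a star. *)
Definition subcube (n d : nat) : Type :=
  {s : n.-tuple (option bool) | count_mem None s == d}.

Definition letter (n d : nat) (s : subcube n d) (j : 'I_n) : option bool :=
  tnth (val s) j.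

Definition vertices (n d : nat) (s : subcube n d) : {set n.-tuple bool} :=
  [set x : n.-tuple bool |
    [forall j : 'I_n, if letter s j is Some b then tnth x j == b else true]].

Definition contained (n l d : nat) (s : subcube n l) (t : subcube n d) : bool :=
  vertices s \subset vertices t.

Definition stars_before (n l : nat) (s : subcube n l) (j : 'I_n) : nat :=
  #|[set k : 'I_n | (k < j) && (letter s k == None)]|.

(* A 1 lies left of the first star (i = 0), between the i-th and (i+1)-st stars
   (0 < i < l) or right of the last star (i = l) exactly when it is preceded by
   i stars. *)
Definition counting_vector (n l : nat) (s : subcube n l) (i : 'I_l.+1) : nat :=
  #|[set j : 'I_n | (letter s j == Some true) && (stars_before s j == i)]|.

Definition coloring (n l : nat) (C : Type) : Type := subcube n l -> C.

Definition polychromatic (d n l : nat) (C : Type) (c : coloring n l C) : Prop :=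
  forall (t : subcube n d) (a : C),
    exists s : subcube n l, contained s t /\ c s = a.

Definition linear_coloring (n l : nat) (Z : finZmodType) (c : coloring n l Z) :
  Prop :=
  exists h : 'I_l.+1 -> Z,
    forall s : subcube n l,
      c s = (\sum_(i < l.+1) h i *+ counting_vector s i)%R.

(* The group may depend on n; only its order M is fixed. *)
Definition lin_achievable (l d M : nat) : Prop :=
  forall n : nat, d <= n ->
    exists (Z : finZmodType) (c : coloring n l Z),
      [/\ #|Z| = M, linear_coloring c & polychromatic d c].

(* M is the maximum number of colors p_lin^l(d); meaningful for 1 <= l <= d. *)
Definition is_p_lin (l d M : nat) : Prop :=
  lin_achievable l d M /\ forall M' : nat, lin_achievable l d M' -> M' <= M.

(* Main.v *)
Require Import Defs.
From mathcomp Require Import all_boot all_order all_algebra.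
From mathcomp Require Import zify.

Set Implicit Arguments.
Unset Strict Implicit.
Unset Printing Implicit Defensive.
Import GRing.Theory.

(** Write [l = d - 1], and let a linear [Q_l]-coloring be given by
    [h_0, ..., h_l].

    Two colors are achieved by coloring with the parity of the number of ones:
    filling any one star of a [Q_d] with 0 and with 1 gives both parities.

    For the upper bound, let [m_i] be the number of ones between the stars [i]
    and [i + 1] (counted from 0) of a [Q_d] that has no ones before its first
    star.  Filling the star [k] with 0 or 1 merges two neighbouring gaps, so the
    colors that occur are [C_k] and [C_k + h_k], where
    [C_{k+1} - C_k = m_k (h_{k+1} - h_k)].  Hence a color [x] is missed as soon
    as the walk [T_k = C_k - x] avoids both [0] and [- h_k] for each [k <= l].
    The multiplicities [m_k] are free, and so is the starting point [T_0],
    through [x].  The lemma [avoiding_walk] shows that whatever [h] is, a single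
    start [b] besides 0 has to be excluded, and that all [m_k] may be taken at
    most 2; so if the group has three elements, some start works.

    Since [m_k <= 2], the walk is realized in dimension [3 d] by a string made
    of [d] blocks of three letters, a star followed by two bits
    ([block_letter], [color_block_face]). *)

(** * Walks in an abelian group that avoid two points at each time *)

(** The walk is built from its last step backwards, so the induction removes
    the first point of [h].  When [h 0 = 0], the walk can stay where it is during
    the first step, and [b] is inherited from the later steps; when [h 0] is
    nonzero, excluding [- h 0] is enough.  The clause recording the value of [b]
    in this second case is what the induction needs. *)
Lemma avoiding_walk (Z : zmodType) (N : nat) (h : nat -> Z) :
  exists b : Z, (h 0 != 0%R -> b = - h 0)%R /\
    forall T : Z, T != 0%R -> T != b -> exists m : nat -> nat,
      (forall i, m i <= 2) /\
      forall k, k <= N ->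
        let Tk := (T + \sum_(0 <= i < k) (h i.+1 - h i) *+ m i)%R in
        Tk != 0%R /\ Tk != (- h k)%R.
Proof.
elim: N h => [|N IHN] h.
  exists (- h 0)%R; split=> // T T0 Tb; exists (fun=> 0); split=> // k.
  by rewrite leqn0 => /eqP-> /=; rewrite big_geq // addr0.
have [b' [b'E walk]] := IHN (fun i => h i.+1).
(* It suffices to find a first step that leads outside [0] and [b']. *)
have step (T : Z) : T != 0%R -> T != (- h 0)%R ->
    (exists2 m0, m0 <= 2 & let T' := (T + (h 1 - h 0) *+ m0)%R in
       T' != 0%R /\ T' != b') ->
    exists m : nat -> nat, (forall i, m i <= 2) /\
      forall k, k <= N.+1 ->
        let Tk := (T + \sum_(0 <= i < k) (h i.+1 - h i) *+ m i)%R in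
        Tk != 0%R /\ Tk != (- h k)%R.
  move=> T0 Th [m0 m0le /= [T'0 T'b]].
  have [m [mle mP]] := walk _ T'0 T'b.
  exists (fun i => if i is i'.+1 then m i' else m0); split; first by case.
  case=> [|k] kN /=; first by rewrite big_geq // addr0.
  by rewrite big_nat_recl // addrA; apply: mP.
have [h0|h0] := eqVneq (h 0) 0%R.
  exists b'; split=> //.
  move=> T T0 Tb; apply: step => //; first by rewrite h0 oppr0.
  by exists 0; rewrite // mulr0n addr0.
exists (- h 0)%R; split=> // T T0 Th; apply: step => //.
have [Tb|Tb] := eqVneq T b'; last by exists 0; rewrite // mulr0n addr0.
have [h1|h1] := eqVneq (h 1) 0%R.
  (* Here the steps are [- h 0]: one step fails only if it leads to 0, and
     then [T = h 0] and two steps lead to [- h 0]. *)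
  have [Th0|Th0] := eqVneq T (h 0); last first.
    exists 1; rewrite //= mulr1n h1 sub0r subr_eq0; split=> //.
    by rewrite -Tb -subr_eq0 addrAC subrr sub0r oppr_eq0.
  exists 2; rewrite //= h1 sub0r mulr2n addrA -Tb Th0 subrr sub0r oppr_eq0.
  by split=> //; rewrite -Th0 eq_sym Th0 -{1}Th0.
(* Here [T = - h 1], and one step leads to [- h 0]. *)
exists 1; rewrite //= mulr1n -Tb Tb b'E // addrA addNr sub0r oppr_eq0.
by split=> //; rewrite eq_sym -b'E // -Tb.
Qed.

(** * Strings, stars and colors *)

Lemma card_stars (n l : nat) (s : subcube n l) :
  #|[set j | letter s j == None]| = l.
Proof.
rewrite -[RHS](eqP (valP s)) -sum1_count big_tuple /= -sum1_card.
by apply: eq_bigl => j; rewrite inE.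
Qed.

Lemma subcube_of_letters (n l : nat) (f : 'I_n -> option bool) :
  #|[set j | f j == None]| = l ->
  exists s : subcube n l, forall j, letter s j = f j.
Proof.
move=> fl.
have sP : count_mem None [tuple f j | j < n] == l.
  rewrite -fl -sum1_count big_tuple -sum1_card; apply/eqP/eq_bigl => j.
  by rewrite inE tnth_mktuple.
by exists (Sub [tuple f j | j < n] sP) => j; rewrite /letter tnth_mktuple.
Qed.

Lemma contained_letter (n l d : nat) (s : subcube n l) (t : subcube n d)
    (j : 'I_n) (b : bool) :
  contained s t -> letter t j = Some b -> letter s j = Some b.
Proof.
move=> /subsetP st tj.
(* The vertex of [s] that takes the value [~~ b] on all stars of [s]. *)
pose x := [tuple (if letter s i is Some c then c else ~~ b) | i < n].
have /st : x \in vertices s.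
  rewrite inE; apply/forallP => i; rewrite tnth_mktuple.
  by case: (letter s i).
rewrite inE => /forallP/(_ j); rewrite tj tnth_mktuple.
by case: (letter s j) => [c /eqP->|] //; case: b {tj x}.
Qed.

Lemma letters_contained (n l d : nat) (s : subcube n l) (t : subcube n d) :
  (forall j b, letter t j = Some b -> letter s j = Some b) -> contained s t.
Proof.
move=> st; apply/subsetP => x; rewrite !inE => /forallP xs.
apply/forallP => j; case tj: (letter t j) => [b|] //.
by have := xs j; rewrite (st _ _ tj).
Qed.

(** A facet keeps all stars of [t] but one, because the star sets are nested
    and their sizes differ by one. *)
Lemma facet_filled_star (n l : nat) (s : subcube n l) (t : subcube n l.+1) :
  contained s t ->
  exists p : 'I_n, [/\ letter t p = None, letter s p != None &
    forall j, j != p -> letter s j = letter t j].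
Proof.
move=> st.
set A := [set j | letter s j == None]; set B := [set j | letter t j == None].
have AB : A \subset B.
  apply/subsetP => j; rewrite !inE => /eqP sj.
  case tj: (letter t j) => [b|] //.
  by rewrite (contained_letter st tj) in sj.
have /eqP/cards1P[p BAp] : #|B :\: A| = 1.
  by rewrite cardsDS // !card_stars subSnn.
have := set11 p; rewrite -BAp !inE => /andP[sp /eqP tp].
exists p; split=> // j jp.
case tj: (letter t j) => [b|]; first exact: contained_letter st tj.
have : j \notin B :\: A by rewrite BAp inE.
by rewrite !inE tj eqxx andbT negbK => /eqP.
Qed.

Lemma stars_before_le (n l : nat) (s : subcube n l) (j : 'I_n) :
  stars_before s j <= l.
Proof.
rewrite -[leqRHS](card_stars s); apply: subset_leq_card.
by apply/subsetP => k; rewrite !inE => /andP[].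
Qed.

(** The ones of a string, grouped by the number of stars before them, make up
    the counting vector. *)
Lemma linear_color_sum_ones (n l : nat) (Z : zmodType) (h : 'I_l.+1 -> Z)
    (s : subcube n l) :
  (\sum_(i < l.+1) h i *+ counting_vector s i =
   \sum_(j < n) if letter s j == Some true
                then h (inord (stars_before s j)) else 0)%R.
Proof.
rewrite -big_mkcond /=.
rewrite (partition_big (fun j => inord (stars_before s j) : 'I_l.+1) xpredT) //=.
apply: eq_bigr => i _.
rewrite (eq_bigr (fun=> h i)) => [|j /andP[_ /eqP->] //].
rewrite sumr_const; congr (_ *+ _)%R.
apply: eq_card => j; rewrite inE unfold_in /=; congr (_ && _).
by rewrite -val_eqE /= inordK // ltnS stars_before_le.
Qed.

Lemma stars_before_nat (n l : nat) (s : subcube n l) (P : pred nat) (j : 'I_n) :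
  (forall k : 'I_n, (letter s k == None) = P k) ->
  stars_before s j = \sum_(0 <= k < j) P k.
Proof.
move=> sP; rewrite /stars_before -sum1dep_card.
rewrite (big_nat_widen _ _ n) 1?ltnW // big_mkord.
rewrite big_mkcondr /=; apply: eq_big => // k _.
by rewrite sP; case: (P k).
Qed.

(** * Strings of blocks *)

Lemma big_blocks (R : Type) (idx : R) (op : Monoid.law idx) (d : nat)
    (F : nat -> R) :
  \big[op/idx]_(0 <= j < 3 * d) F j =
  \big[op/idx]_(0 <= i < d) op (op (F (3 * i)) (F (3 * i).+1)) (F (3 * i).+2).
Proof.
elim: d => [|d IHd]; first by rewrite muln0 !big_geq.
by rewrite mulnSr addn3 !big_nat_recr //= IHd !Monoid.mulmA.
Qed.

Definition block_letter (m : nat -> nat) (j : nat) : option bool :=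
  if j %% 3 == 0 then None else Some (j %% 3 <= m (j %/ 3)).

Lemma card_block_stars (d : nat) (m : nat -> nat) :
  #|[set j : 'I_(3 * d) | block_letter m j == None]| = d.
Proof.
rewrite -sum1dep_card big_mkcond /=.
rewrite -(big_mkord xpredT (fun j => if block_letter m j == None then 1 else 0)).
rewrite big_blocks (eq_bigr (fun=> 1)) ?sum_nat_const_nat ?subn0 ?muln1 // => i _.
rewrite /block_letter.
have -> : (3 * i) %% 3 = 0 by lia.
have -> : (3 * i).+1 %% 3 = 1 by lia.
by have -> : (3 * i).+2 %% 3 = 2 by lia.
Qed.

Lemma count_block_stars (k r : nat) :
  \sum_(0 <= j < r) ((j %% 3 == 0) && (j != 3 * k)) =
  (r + 2) %/ 3 - (3 * k < r).
Proof.
elim: r => [|r IHr]; first by rewrite big_geq.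
by rewrite big_nat_recr //= IHr; lia.
Qed.

(** The color of the facet obtained by writing [e] at star number [k] of a
    block string: the ones of block [i] have lost a star on their left exactly
    when [k <= i]. *)
Lemma color_block_face (l k : nat) (Z : zmodType) (h : 'I_l.+1 -> Z)
    (m : nat -> nat) (e : bool) (s : subcube (3 * l.+1) l) :
  (forall i, m i <= 2) -> k < l.+1 ->
  (forall j : 'I_(3 * l.+1),
     letter s j = if j == 3 * k :> nat then Some e else block_letter m j) ->
  (\sum_(i < l.+1) h i *+ counting_vector s i =
   h (inord k) *+ e +
   \sum_(0 <= i < l.+1) h (inord (i + (i < k))) *+ m i)%R.
Proof.
move=> mle kl sE; rewrite linear_color_sum_ones.
pose P j := (j %% 3 == 0) && (j != 3 * k).
have starP (j : 'I_(3 * l.+1)) : (letter s j == None) = P j.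
  rewrite sE /P /block_letter; case: (_ == 3 * k :> nat); first by rewrite andbF.
  by case: (_ %% 3 == 0).
pose F (j : nat) : Z :=
  if (if j == 3 * k then Some e else block_letter m j) == Some true
  then h (inord ((j + 2) %/ 3 - (3 * k < j))) else 0%R.
rewrite (eq_bigr (fun j : 'I__ => F j)) => [|j _]; last first.
  by rewrite /F -sE (stars_before_nat (P := P) j starP) count_block_stars.
rewrite -(big_mkord xpredT F) big_blocks.
rewrite [in RHS](_ : h (inord k) *+ e =
    \sum_(0 <= i < l.+1) if i == k then h (inord k) *+ e else 0)%R; last first.
  rewrite (bigD1_seq k) ?mem_index_iota ?iota_uniq //= eqxx.
  by rewrite big1 ?addr0 // => i /negPf->.
rewrite -big_split /=; apply: eq_bigr => i _.
rewrite -addrA /F /block_letter; congr (_ + _)%R.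
  have -> : (3 * i) %% 3 = 0 by lia.
  have -> : (3 * i == 3 * k) = (i == k) by lia.
  have [->|//] := eqVneq i k.
  have -> : (3 * k + 2) %/ 3 - (3 * k < 3 * k) = k by lia.
  by case: e {sE F}.
have -> : (3 * i).+1 %% 3 = 1 by lia.
have -> : (3 * i).+2 %% 3 = 2 by lia.
have -> : (3 * i).+1 %/ 3 = i by lia.
have -> : (3 * i).+2 %/ 3 = i by lia.
have -> : ((3 * i).+1 == 3 * k) = false by lia.
have -> : ((3 * i).+2 == 3 * k) = false by lia.
have -> : ((3 * i).+1 + 2) %/ 3 - (3 * k < (3 * i).+1) = i + (i < k) by lia.
have -> : ((3 * i).+2 + 2) %/ 3 - (3 * k < (3 * i).+2) = i + (i < k) by lia.
by case: (m i) (mle i) => [|[|[|//]]] _ /=; rewrite ?addr0 ?mulr2n.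
Qed.

(** * The two bounds *)

Lemma exists_avoiding_two (Z : finZmodType) (b : Z) :
  2 < #|Z| -> exists T : Z, T != 0%R /\ T != b.
Proof.
move=> Z3; have : 0 < #|~: [set 0%R; b]|.
  rewrite cardsCs setCK subn_gt0; apply: leq_ltn_trans Z3.
  by rewrite cards2; case: (_ != _).
by case/card_gt0P=> T; rewrite !inE negb_or => /andP[T0 Tb]; exists T.
Qed.

Lemma lin_achievable_le2 (l M : nat) : lin_achievable l l.+1 M -> M <= 2.
Proof.
case/(_ (3 * l.+1)); first by lia.
move=> Z [c [<- [h cE] poly]]; rewrite leqNgt; apply/negP => Z3.
pose hn i := h (inord i).
have [b [_ walk]] := avoiding_walk l hn.
have [T0 [T00 T0b]] := exists_avoiding_two b Z3.
have [m [mle mP]] := walk _ T00 T0b.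
have [t tE] := subcube_of_letters (card_block_stars l.+1 m).
pose C (k : nat) := (\sum_(0 <= i < l.+1) hn (i + (i < k))%N *+ m i)%R.
have CE k : k <= l ->
    (C k = C 0 + \sum_(0 <= i < k) (hn i.+1 - hn i) *+ m i)%R.
  move=> kl; apply/eqP; rewrite addrC -subr_eq -sumrB; apply/eqP.
  rewrite (big_nat_widen 0 k l.+1) 1?leqW // [RHS]big_mkcond /=.
  apply: eq_bigr => i _; rewrite addn0 -mulrnBl.
  by case: (i < k); rewrite ?addn1 // addn0 subrr mul0rn.
have [s [st cs]] := poly t (C 0 - T0)%R.
have [p [tp sp sE]] := facet_filled_star st.
have p3 : p = 3 * (p %/ 3) :> nat.
  by move: tp; rewrite tE /block_letter; case: eqP => // + _; lia.
have kl : p %/ 3 < l.+1 by have := ltn_ord p; lia.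
set k := p %/ 3 in p3 kl.
case sp': (letter s p) sp => [e|] // _.
have sblock (j : 'I_(3 * l.+1)) :
    letter s j = if j == 3 * k :> nat then Some e else block_letter m j.
  rewrite -p3; have [/val_inj->//|jp] := eqVneq (val j) (val p).
  by rewrite sE ?tE.
have := color_block_face h mle kl sblock; rewrite -cE cs -/(C k).
have [] := mP k kl.
rewrite (CE k) //; set S := (\sum_(0 <= i < k) _)%R => Tk0 Tkh.
rewrite addrCA => /addrI /eqP; rewrite -/(hn k) eq_sym -subr_eq0 opprK.
rewrite -addrA addrC addr_eq0 (addrC S).
by case: e {sp' sblock} => /=; rewrite ?oppr0 ?(negPf Tkh) ?(negPf Tk0).
Qed.

(** With all [h i = 1] in Z/2, the color is the parity of the number of ones,
    so filling one fixed star of [t] by 0 and by 1 gives both colors. *)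
Lemma lin_achievable2 (l : nat) : lin_achievable l l.+1 2.
Proof.
move=> n _; pose h (_ : 'I_l.+1) : 'Z_2 := 1%R.
exists ('Z_2 : finZmodType).
exists (fun s => \sum_(i < l.+1) h i *+ counting_vector s i)%R.
split; [by rewrite card_ord | by exists h |] => t a.
have /card_gt0P[p] : 0 < #|[set j | letter t j == None]| by rewrite card_stars.
rewrite inE => /eqP tp.
pose f b j := if j == p then Some b else letter t j.
have fl b : #|[set j | f b j == None]| = l.
  have := card_stars t; rewrite (cardsD1 p) inE tp eqxx add1n => -[<-].
  by apply: eq_card => j; rewrite !inE /f; case: (j == p).
pose r : 'Z_2 := (\sum_(j < n | j != p) (letter t j == Some true)%:R)%R.
(* The bit that corrects the parity [r] of the remaining ones to [a]. *)
pose b := (a - r == 1)%R.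
have [s sE] := subcube_of_letters (fl b).
exists s; split.
  apply: letters_contained => j c tj; rewrite sE /f.
  by have [jp|//] := eqVneq j p; rewrite jp tp in tj.
rewrite linear_color_sum_ones (bigD1 p) //= sE /f eqxx.
rewrite (eq_bigr (fun j => (letter t j == Some true)%:R)%R); last first.
  by move=> j jp; rewrite sE /f (negPf jp); case: (_ == _).
apply/eqP; rewrite -/r eq_sym -subr_eq.
rewrite /b; move: (a - r)%R => {fl sE}.
by case=> -[|[|z]] zP; apply/eqP; apply: val_inj.
Qed.

Theorem theorem7 (d : nat) (hd : 3 <= d) : is_p_lin d.-1 d 2.
Proof.
case: d hd => // l _; split; first exact: lin_achievable2.
exact: lin_achievable_le2.
Qed.
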